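(* Let $\mathbf{Z}_1,\ldots,\mathbf{Z}_n\in\mathbb{R}^k$ be $n\ge k+1$ data points in general position. Then, for any $\ell\in\{1,2,\ldots,n-k\}$ such that the empirical halfspace depth region $D^{(n)}(\frac{\ell}{n})$ has a nonempty interior, we have $R^{(n)}(\tau)=D^{(n)}(\frac{\ell}{n})$ for all positive $\tau$ in $[\frac{\ell-1}{n},\frac{\ell}{n})$.
   Context: A prime denotes transpose. $\mathcal{S}^{k-1}$ is the unit sphere of $\mathbb{R}^k$. General position means that no hyperplane of $\mathbb{R}^k$ contains more than $k$ of the data points (any $k+1$ of the points are affinely independent). The check function is $\rho_\tau(x):=x(\tau-\mathbb{I}_{[x<0]})$. For $\mathbf{u}\in\mathcal{S}^{k-1}$, $\boldsymbol{\Gamma}_{\mathbf{u}}$ is an arbitrary $k\times(k-1)$ matrix such that $(\mathbf{u}\,\vdots\,\boldsymbol{\Gamma}_{\mathbf{u}})$ is orthogonal (its choice does not affect the halfspaces below). Empirical quantile halfspaces: for $\boldsymbol{\tau}=\tau\mathbf{u}$ with $\tau\in(0,1)$, $\mathbf{u}\in\mathcal{S}^{k-1}$, and any minimizer $(a^{(n)}_{\boldsymbol{\tau}},\mathbf{b}^{(n)\prime}_{\boldsymbol{\tau}})'$ over $\mathbb{R}\times\mathbb{R}^{k-1}$ of $$\Psi^{(n)}_{\boldsymbol{\tau}}(a,\mathbf{b}):=\frac1n\sum_{i=1}^n\rho_\tau(\mathbf{u}'\mathbf{Z}_i-\mathbf{b}'\boldsymbol{\Gamma}_{\mathbf{u}}'\mathbf{Z}_i-a),$$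 an upper $\boldsymbol{\tau}$-quantile halfspace is $H^{(n)+}_{\boldsymbol{\tau}}:=\{\mathbf{z}\in\mathbb{R}^k:\mathbf{u}'\mathbf{z}\ge\mathbf{b}^{(n)\prime}_{\boldsymbol{\tau}}\boldsymbol{\Gamma}_{\mathbf{u}}'\mathbf{z}+a^{(n)}_{\boldsymbol{\tau}}\}$; minimizers, hence such halfspaces, need not be unique. Empirical quantile regions: for $\tau\in(0,1)$, $R^{(n)}(\tau):=\bigcap_{\mathbf{u}\in\mathcal{S}^{k-1}}\bigcap\{H^{(n)+}_{\tau\mathbf{u}}\}$, where $\bigcap\{H^{(n)+}_{\tau\mathbf{u}}\}$ is the intersection of the collection of all upper $(\tau\mathbf{u})$-quantile halfspaces (over all minimizers). Empirical halfspace (Tukey) depth regions: with $\mathrm{P}_n$ the empirical measure of $\mathbf{Z}_1,\ldots,\mathbf{Z}_n$, $D^{(n)}(\tau):=\{\mathbf{z}\in\mathbb{R}^k:HD(\mathbf{z},\mathrm{P}_n)\ge\tau\}$, where $HD(\mathbf{z},\mathrm{P}_n):=\inf\{\mathrm{P}_n[H]:H\text{ is a closed halfspace containing }\mathbf{z}\}$. *)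

(* Defs.v *)
From mathcomp Require Import all_boot all_order all_algebra.
From mathcomp Require Import all_classical all_reals all_analysis.
Set Implicit Arguments.
Unset Strict Implicit.
Unset Printing Implicit Defensive.
Import Order.TTheory GRing.Theory Num.Theory.
Import numFieldNormedType.Exports.
Local Open Scope classical_set_scope.
Local Open Scope ring_scope.

(* Points of R^k are column vectors. *)

Definition dot (R : realType) (k : nat) (x y : 'cV[R]_k) : R :=
  (x^T *m y) 0 0.

(* The norm `|x| of the library on matrices is the sup norm, hence the
   separate Euclidean norm; both induce the same topology. *)
Definition enorm (R : realType) (k : nat) (x : 'cV[R]_k) : R :=
  Num.sqrt (dot x x).

Definition unit_sphere (R : realType) (k : nat) : set 'cV[R]_k :=
  [set u | enorm u = 1].

(* Stated for rectangular shapes because the width of (u | Gamma_u) is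
   1 + k.-1, which is not syntactically k; both equations together force the
   matrix to be square. *)
Definition orthogonal_mx (R : realType) (m p : nat) (A : 'M[R]_(m, p)) : Prop :=
  A^T *m A = 1%:M /\ A *m A^T = 1%:M.

Definition hyperplane (R : realType) (k : nat) (c : 'cV[R]_k) (d : R) :
    set 'cV[R]_k :=
  [set z | dot c z = d].

(* Data points are counted with multiplicity (by index). *)
Definition general_position (R : realType) (k n : nat)
    (Z : 'I_n -> 'cV[R]_k) : Prop :=
  forall (c : 'cV[R]_k) (d : R), c != 0 ->
    (#|[pred i | Z i \in hyperplane c d]| <= k)%N.

Definition check_fun (R : realType) (tau x : R) : R :=
  x * (tau - (x < 0)%R%:R).

Definition Psi (R : realType) (k n : nat) (Z : 'I_n -> 'cV[R]_k) (tau : R)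
    (u : 'cV[R]_k) (G : 'M[R]_(k, k.-1)) (a : R) (b : 'cV[R]_(k.-1)) : R :=
  n%:R^-1 * \sum_(i < n) check_fun tau (dot u (Z i) - dot b (G^T *m Z i) - a).

Definition is_quantile_coef (R : realType) (k n : nat) (Z : 'I_n -> 'cV[R]_k)
    (tau : R) (u : 'cV[R]_k) (G : 'M[R]_(k, k.-1)) (a : R)
    (b : 'cV[R]_(k.-1)) : Prop :=
  forall (a' : R) (b' : 'cV[R]_(k.-1)),
    Psi Z tau u G a b <= Psi Z tau u G a' b'.

Definition upper_halfspace (R : realType) (k : nat) (u : 'cV[R]_k)
    (G : 'M[R]_(k, k.-1)) (a : R) (b : 'cV[R]_(k.-1)) : set 'cV[R]_k :=
  [set z | dot u z >= dot b (G^T *m z) + a].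

Definition upper_quantile_halfspaces (R : realType) (k n : nat)
    (Z : 'I_n -> 'cV[R]_k) (tau : R) (u : 'cV[R]_k) (G : 'M[R]_(k, k.-1)) :
    set (set 'cV[R]_k) :=
  [set H | exists (a : R) (b : 'cV[R]_(k.-1)),
    is_quantile_coef Z tau u G a b /\ H = upper_halfspace u G a b].

Definition quantile_region (R : realType) (k n : nat) (Z : 'I_n -> 'cV[R]_k)
    (Gamma : 'cV[R]_k -> 'M[R]_(k, k.-1)) (tau : R) : set 'cV[R]_k :=
  \bigcap_(u in @unit_sphere R k)
    \bigcap_(H in upper_quantile_halfspaces Z tau u (Gamma u)) H.

Definition empirical_measure (R : realType) (k n : nat)
    (Z : 'I_n -> 'cV[R]_k) (H : set 'cV[R]_k) : R :=
  n%:R^-1 * \sum_(i < n) \1_H (Z i).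

Definition closed_halfspace (R : realType) (k : nat) (H : set 'cV[R]_k) : Prop :=
  exists (c : 'cV[R]_k) (d : R), c != 0 /\ H = [set z | dot c z >= d].

Definition halfspace_depth (R : realType) (k n : nat) (Z : 'I_n -> 'cV[R]_k)
    (z : 'cV[R]_k) : R :=
  inf [set empirical_measure Z H | H in [set H | closed_halfspace H /\ H z]].

Definition depth_region (R : realType) (k n : nat) (Z : 'I_n -> 'cV[R]_k)
    (tau : R) : set 'cV[R]_k :=
  [set z | halfspace_depth Z z >= tau].

(* Main.v *)
(* Both inclusions rest on the subgradient condition of quantile regression for
   a hyperplane [dot c z = a]: at most [n tau] points lie strictly below it, and
   at least [n tau] lie on or below it.  Every minimizer satisfies the first
   half, so a point cut off by a quantile halfspace has depth less than [l / n].
   Conversely, every hyperplane satisfying the whole condition (and not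
   containing all the data) is a quantile hyperplane in some direction: pick
   subgradients [g_i] of the check function at the residuals with
   [\sum_i g_i = 0]; then the direction of [\sum_i g_i Z_i] works.  A point [z]
   of depth less than [l / n] lies in a halfspace [dot c y <= d] with fewer than
   [l] data points, and the [l]-th order statistic of [dot c (Z i)] gives such a
   hyperplane with [z] strictly below it. *)
Require Import Defs.
From mathcomp Require Import all_boot all_order all_algebra.
From mathcomp Require Import all_classical all_reals all_analysis.
From mathcomp Require Import ring lra.
Set Implicit Arguments.
Unset Strict Implicit.
Unset Printing Implicit Defensive.
Import Order.TTheory GRing.Theory Num.Theory.
Import numFieldNormedType.Exports.
Local Open Scope classical_set_scope.
Local Open Scope ring_scope.

(** * Inner product, Euclidean norm and orthogonal frames *)

Section Dot.
Context {R : realType} {k : nat}.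
Implicit Types x y z : 'cV[R]_k.

Lemma dotC x y : dot x y = dot y x.
Proof. by rewrite /dot -[in LHS](trmxK y) -trmx_mul mxE. Qed.

Lemma dotDl x y z : dot (x + y) z = dot x z + dot y z.
Proof. by rewrite /dot linearD mulmxDl mxE. Qed.

Lemma dotNl x y : dot (- x) y = - dot x y.
Proof. by rewrite /dot linearN mulNmx mxE. Qed.

Lemma dotZl a x y : dot (a *: x) y = a * dot x y.
Proof. by rewrite /dot linearZ -scalemxAl mxE. Qed.

Lemma dot0l y : dot 0 y = 0.
Proof. by rewrite /dot trmx0 mul0mx mxE. Qed.

Lemma dotZr a x y : dot x (a *: y) = a * dot x y.
Proof. by rewrite dotC dotZl dotC. Qed.

Lemma dot0r x : dot x 0 = 0.
Proof. by rewrite dotC dot0l. Qed.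

Lemma dot_sumZr n x (g : 'I_n -> R) (Z : 'I_n -> 'cV[R]_k) :
  dot x (\sum_i g i *: Z i) = \sum_i g i * dot x (Z i).
Proof.
by rewrite /dot mulmx_sumr summxE; apply: eq_bigr => i _; rewrite -scalemxAr mxE.
Qed.

Lemma dot_mull m (G : 'M[R]_(k, m)) (b : 'cV[R]_m) z :
  dot (G *m b) z = dot b (G^T *m z).
Proof. by rewrite /dot trmx_mul mulmxA. Qed.

Lemma dot_ge0 x : 0 <= dot x x.
Proof.
rewrite /dot mxE; apply: sumr_ge0 => i _; rewrite mxE -expr2; exact: sqr_ge0.
Qed.

Lemma dot_eq0 x : dot x x = 0 -> x = 0.
Proof.
rewrite /dot mxE => h; apply/matrixP => i j; rewrite (ord1 j) mxE.
have /(_ i isT) : forall i, true -> x^T 0 i * x i 0 = 0.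
  apply: psumr_eq0P => // l _; rewrite mxE -expr2; exact: sqr_ge0.
by rewrite mxE => /eqP; rewrite mulf_eq0 orbb => /eqP.
Qed.

Lemma unit_sphere_dot x : unit_sphere x -> dot x x = 1.
Proof. by move=> h; rewrite -(sqr_sqrtr (dot_ge0 x)) -/(enorm x) h expr1n. Qed.

Lemma enorm_gt0 x : x != 0 -> 0 < enorm x.
Proof.
move=> x0; rewrite sqrtr_gt0 lt_neqAle dot_ge0 andbT eq_sym.
by apply: contra x0 => /eqP/dot_eq0 ->.
Qed.

Lemma unit_sphere_normalize x : x != 0 -> unit_sphere ((enorm x)^-1 *: x).
Proof.
move=> x0; have e0 := enorm_gt0 x0.
rewrite /unit_sphere /= [LHS]/enorm dotZl dotZr.
have -> : dot x x = enorm x ^+ 2 by rewrite sqr_sqrtr ?dot_ge0.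
by rewrite expr2 mulKf ?gt_eqF// mulVf ?gt_eqF// sqrtr1.
Qed.

(** Read off a block of [A^T A = 1], and expand [A A^T = u u^T + G G^T = 1] at [c]. *)
Lemma orthogonal_row_mx m (u : 'cV[R]_k) (G : 'M[R]_(k, m)) :
  orthogonal_mx (row_mx u G) ->
  G^T *m u = 0 /\ (forall c, G *m (G^T *m c) = c - dot u c *: u).
Proof.
rewrite /orthogonal_mx tr_row_mx mul_col_row mul_row_col => -[h1 h2]; split.
  have /(congr1 dlsubmx) := h1.
  by rewrite block_mxKdl scalar_mx_block block_mxKdl.
move=> c; apply/eqP; rewrite eq_sym subr_eq; apply/eqP.
rewrite -[LHS]mul1mx -h2 mulmxDl addrC mulmxA -(mulmxA u) [u^T *m c]mx11_scalar.
by rewrite mul_mx_scalar.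
Qed.

End Dot.

(** * Convexity and positivity of the check function *)

Section CheckFun.
Context {R : realType} (tau : R).

(** The check function is the maximum of the lines of slopes [tau - 1] and [tau], so slopes in
    between are subgradients at 0. *)
Lemma check_fun_ge_subgradient (g x : R) :
  tau - 1 <= g -> g <= tau -> g * x <= check_fun tau x.
Proof. by rewrite /check_fun; case: (ltP x 0) => /= *; nra. Qed.

Lemma check_fun_gt0 (x : R) : 0 < tau -> tau < 1 -> x != 0 ->
  0 < check_fun tau x.
Proof. by rewrite /check_fun; case: (ltgtP x 0) => //= *; nra. Qed.

Lemma check_fun_ge0 (x : R) : 0 < tau -> tau < 1 -> 0 <= check_fun tau x.
Proof. by rewrite /check_fun; case: (ltgtP x 0) => //= *; nra. Qed.

End CheckFun.

(** * Quantiles of finitely many reals *)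

Section OrderStatistics.
Context {R : realType} {n : nat}.
Implicit Types (r : 'I_n -> R) (P : pred 'I_n) (tau a : R).

Lemma sum_nat_of_bool P : \sum_i ((P i)%:R : R) = #|P|%:R.
Proof. by rewrite -natr_sum -sum1_card [in RHS]big_mkcond. Qed.

Lemma sum_mulrB_balanced (g f : 'I_n -> R) (b : R) : \sum_i g i = 0 ->
  \sum_i g i * (f i - b) = \sum_i g i * f i.
Proof.
move=> g0; under eq_bigr do rewrite mulrBr.
by rewrite sumrB -mulr_suml g0 mul0r subr0.
Qed.

Lemma exists_max_lt r a : (0 < #|[pred i | (r i < a)%R]|)%N ->
  exists2 j, r j < a & forall i, r i < a -> r i <= r j.
Proof.
case/card_gt0P => i0 hi0; exists [arg max_(i > i0 | r i < a) r i]%O.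
  by case: arg_maxP.
by case: arg_maxP => // j _ hj i; exact: hj.
Qed.

(** Take the least value with at least [l] values on or below it; were [l] of them strictly below,
    the largest of those would be a smaller candidate. *)
Lemma exists_order_statistic r l : (0 < l <= n)%N ->
  exists a, (#|[pred i | (r i < a)%R]| < l <= #|[pred i | (r i <= a)%R]|)%N.
Proof.
case/andP=> l0 ln; have i0 : 'I_n := Ordinal (leq_trans l0 ln).
have [j0 hj0] : exists j0, (l <= #|[pred i | (r i <= r j0)%R]|)%N.
  exists [arg max_(i > i0) r i]%O; case: arg_maxP => // j _ hj.
  rewrite (eq_card (B := predT)) ?card_ord// => i.
  by rewrite !inE; exact: hj.
pose P := [pred j | (l <= #|[pred i | (r i <= r j)%R]|)%N].
have [j hj jmin] := @arg_minP _ _ _ j0 P r hj0.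
exists (r j); rewrite [X in _ && X]hj andbT ltnNge; apply/negP => hlt.
have [m mlt mmax] := exists_max_lt (leq_trans l0 hlt).
have /jmin : (l <= #|[pred i | (r i <= r m)%R]|)%N.
  apply: leq_trans hlt _; apply: subset_leq_card; apply/fintype.subsetP => i.
  by rewrite !inE; exact: mmax.
by rewrite leNgt mlt.
Qed.

(** Lowering [a] to the next smaller value [r j] makes no residual change sign strictly, so the
    objective drops by [(a - r j) * (#{r < a} - n tau)], which minimality forbids from being
    positive. *)
Lemma check_fun_argmin_card_lt r tau a :
  (forall a', \sum_i check_fun tau (r i - a) <= \sum_i check_fun tau (r i - a')) ->
  0 <= tau ->
  #|[pred i | (r i < a)%R]|%:R <= n%:R * tau.
Proof.
move=> amin tau0; rewrite leNgt; apply/negP => hN.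
have /exists_max_lt[j ja jmax] : (0 < #|[pred i | (r i < a)%R]|)%N.
  rewrite -(ltr_nat R); apply: le_lt_trans hN.
  by rewrite mulr_ge0.
have := amin (r j); apply/negP; rewrite -ltNge -subr_gt0 -sumrB.
rewrite (eq_bigr (fun i => (a - r j) * ((r i < a)%R%:R - tau))); last first.
  move=> i _; rewrite /check_fun !subr_lt0.
  case: (ltP (r i) a) => [/jmax|] h.
    case: (ltgtP (r i) (r j)) h => //= h _; rewrite ?h/=; ring.
  by rewrite ltNge (le_trans (ltW ja) h)/=; ring.
rewrite -mulr_sumr sumrB sum_nat_of_bool sumr_const card_ord -(mulr_natl tau).
by rewrite mulr_gt0 ?subr_gt0.
Qed.

(* The weights are [tau] above level [a], [tau - 1] below it and [tau - theta]
   on it, where [theta] shares [n tau - #{r < a}] evenly among the ties. *)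
Lemma exists_balanced_subgradient r tau a :
  0 < tau < 1 ->
  #|[pred i | (r i < a)%R]|%:R <= n%:R * tau ->
  n%:R * tau <= #|[pred i | (r i <= a)%R]|%:R ->
  exists g : 'I_n -> R, [/\ \sum_i g i = 0,
    forall i, tau - 1 <= g i <= tau &
    forall i, check_fun tau (r i - a) = g i * (r i - a)].
Proof.
move=> /andP[t0 t1].
have -> : #|[pred i | (r i <= a)%R]|%:R =
    #|[pred i | (r i < a)%R]|%:R + #|[pred i | r i == a]|%:R :> R.
  rewrite -!sum_nat_of_bool -big_split/=; apply: eq_bigr => i _.
  by case: (ltgtP (r i) a); rewrite ?addr0 ?add0r.
set N := #|_|%:R; set E := #|_|%:R => hN hE.
have E0 : 0 <= E by exact: ler0n.
have [theta [/andP[th0 th1] thE]] :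
    exists theta, 0 <= theta <= 1 /\ N + theta * E = n%:R * tau.
  have [EE|E'] := eqVneq E 0.
    by exists 0; rewrite lexx ler01; split => //; lra.
  have Ep : 0 < E by rewrite lt_neqAle eq_sym E'.
  exists ((n%:R * tau - N) / E); split; last by field.
  by rewrite divr_ge0 ?subr_ge0//= ler_pdivrMr//; lra.
exists (fun i => tau - (r i < a)%R%:R - theta * (r i == a)%:R); split.
- rewrite !sumrB -mulr_sumr !sum_nat_of_bool sumr_const card_ord -(mulr_natl tau).
  rewrite -/N -/E; lra.
- by move=> i; case: (ltgtP (r i) a) => _ /=; apply/andP; split; lra.
- move=> i; rewrite /check_fun subr_lt0.
  by case: (ltgtP (r i) a) => [_|_|->] /=; ring.
Qed.

End OrderStatistics.

(** * Quantile hyperplanes and the count conditions *)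

Section QuantileHyperplanes.
Context {R : realType} {k n : nat}.
Variables (Z : 'I_n -> 'cV[R]_k) (Gamma : 'cV[R]_k -> 'M[R]_(k, k.-1)).
Hypothesis Gamma_orth : forall u : 'cV[R]_k, unit_sphere u ->
  orthogonal_mx (row_mx u (Gamma u)).

Lemma upper_halfspaceE (u : 'cV[R]_k) (G : 'M[R]_(k, k.-1)) a b :
  upper_halfspace u G a b = [set z | a <= dot (u - G *m b) z].
Proof.
apply/seteqP; split=> z; rewrite /upper_halfspace /= dotDl dotNl dot_mull.
  by rewrite lerBrDl.
by rewrite lerBrDl.
Qed.

Lemma PsiE (tau : R) (u : 'cV[R]_k) (G : 'M[R]_(k, k.-1)) a b :
  Psi Z tau u G a b =
  n%:R^-1 * \sum_i check_fun tau (dot (u - G *m b) (Z i) - a).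
Proof.
by congr (_ * _); apply: eq_bigr => i _; rewrite dotDl dotNl dot_mull.
Qed.

Lemma quantile_coef_card_lt tau (u : 'cV[R]_k) (G : 'M[R]_(k, k.-1)) a b :
  (0 < n)%N -> 0 <= tau -> is_quantile_coef Z tau u G a b ->
  #|[pred i | (dot (u - G *m b) (Z i) < a)%R]|%:R <= n%:R * tau.
Proof.
move=> n0 tau0 hab; apply: check_fun_argmin_card_lt => // a'.
by have := hab a' b; rewrite !PsiE ler_pM2l// invr_gt0 ltr0n.
Qed.

(** With [v = \sum_i g i *: Z i] and [u] along [v], every admissible normal [c' = u - Gamma u *m b']
    has [dot c' v = enorm v]. The subgradient bound on the objective is thus the same for all
    [(a', b')], and a rescaling of [c] attains it. *)
Lemma exists_quantile_direction tau (c : 'cV[R]_k) a :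
  0 < tau < 1 ->
  (exists i, dot c (Z i) != a) ->
  #|[pred i | (dot c (Z i) < a)%R]|%:R <= n%:R * tau ->
  n%:R * tau <= #|[pred i | (dot c (Z i) <= a)%R]|%:R ->
  exists2 u, unit_sphere u &
    upper_quantile_halfspaces Z tau u (Gamma u) [set z | a <= dot c z].
Proof.
move=> t01 [i0 hi0] hN hE.
have [g [g0 gb gE]] := exists_balanced_subgradient t01 hN hE.
have /andP[t0 t1] := t01.
pose v := \sum_i g i *: Z i.
have cvE : dot c v = \sum_i check_fun tau (dot c (Z i) - a).
  by under eq_bigr do rewrite gE; rewrite sum_mulrB_balanced// dot_sumZr.
(* A point off the hyperplane makes the loss positive, so [v] has a direction. *)
have cv : 0 < dot c v.
  rewrite cvE (bigD1 i0)//= ltr_pwDl//; first by rewrite check_fun_gt0// subr_eq0.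
  by apply: sumr_ge0 => i _; exact: check_fun_ge0.
have v0 : v != 0 by apply: contraTneq cv => ->; rewrite dot0r ltxx.
have e0 := enorm_gt0 v0.
pose u := (enorm v)^-1 *: v.
have us : unit_sphere u := unit_sphere_normalize v0.
exists u => //.
have [Gu GG] := orthogonal_row_mx (Gamma_orth us).
have vE : v = enorm v *: u by rewrite scalerA mulfV ?scale1r// gt_eqF.
(* Admissible normals have component 1 along [u], so [c] must be divided by [s]. *)
pose s := dot u c.
have s0 : 0 < s by rewrite /s dotC dotZr mulr_gt0// invr_gt0.
clearbody u.
have cE : u - Gamma u *m (- (Gamma u)^T *m (s^-1 *: c)) = s^-1 *: c.
  rewrite mulNmx mulmxN opprK GG dotC dotZl dotC -/s mulVf ?gt_eqF// scale1r.
  by rewrite addrC subrK.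
exists (s^-1 * a), (- (Gamma u)^T *m (s^-1 *: c)); split; last first.
  rewrite upper_halfspaceE cE; apply/seteqP; split=> z /=;
  by rewrite dotZl ler_pM2l// invr_gt0.
move=> a' b'; rewrite !PsiE cE; apply: ler_wpM2l; first by rewrite invr_ge0.
(* Positive homogeneity of the check function: the [g i] still fit the rescaled residuals. *)
have -> : \sum_i check_fun tau (dot (s^-1 *: c) (Z i) - s^-1 * a) =
    \sum_i g i * dot (s^-1 *: c) (Z i).
  rewrite -(sum_mulrB_balanced _ (s^-1 * a) g0).
  apply: eq_bigr => i _; rewrite dotZl -!mulrBr mulrCA -gE.
  by rewrite /check_fun pmulr_rlt0 ?invr_gt0// -mulrA.
rewrite -dot_sumZr -/v.
have <- : dot (u - Gamma u *m b') v = dot (s^-1 *: c) v.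
  rewrite vE !dotZr dotDl dotNl dot_mull Gu dot0r subr0 dotZl.
  by rewrite (dotC c) -/s mulVf ?gt_eqF// (unit_sphere_dot us).
rewrite dot_sumZr -(sum_mulrB_balanced _ a' g0).
apply: ler_sum => i _; have /andP[? ?] := gb i.
exact: check_fun_ge_subgradient.
Qed.

End QuantileHyperplanes.

(** * Halfspace depth as a count of points *)

Section Depth.
Context {R : realType} {k n : nat}.
Variable Z : 'I_n -> 'cV[R]_k.

Lemma empirical_measureE (H : set 'cV[R]_k) :
  empirical_measure Z H = #|[pred i | Z i \in H]|%:R / n%:R.
Proof. by rewrite mulrC -sum_nat_of_bool. Qed.

Lemma halfspace_depth_ltP (z : 'cV[R]_k) (l : nat) : (0 < k)%N -> (0 < n)%N ->
  halfspace_depth Z z < l%:R / n%:R <->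
  exists c : 'cV[R]_k, exists d, [/\ c != 0, dot c z <= d &
    (#|[pred i | (dot c (Z i) <= d)%R]| < l)%N].
Proof.
move=> k0 n0; have n0R : 0 < n%:R :> R by rewrite ltr0n.
have cardE (c : 'cV[R]_k) d : #|[pred i | Z i \in [set y | - d <= dot (- c) y]]| =
    #|[pred i | (dot c (Z i) <= d)%R]|.
  apply: eq_card => i; rewrite !inE; apply/idP/idP.
    by move/set_mem; rewrite /= dotNl lerN2.
  by move=> h; apply/mem_set; rewrite /= dotNl lerN2.
split=> [|[c [d [c0 hz hl]]]].
- move/inf_lt => [|_ [H [[c [d [c0 ->]]] Hz] <-]].
    (* The infimum is over a nonempty set: any nonzero normal gives a halfspace with [z] on its
       boundary. *)
    pose e : 'cV[R]_k := const_mx 1.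
    exists (empirical_measure Z [set y | dot e z <= dot e y]).
    exists [set y | dot e z <= dot e y]; split=> //=.
    exists e, (dot e z); split=> //; apply/eqP => /matrixP/(_ (Ordinal k0) 0).
    by rewrite !mxE; apply/eqP; exact: oner_neq0.
  rewrite empirical_measureE ltr_pM2r ?invr_gt0// ltr_nat => hl.
  exists (- c), (- d); split; rewrite ?oppr_eq0 ?dotNl ?lerN2//.
  by move: hl; rewrite -cardE !opprK.
- apply: (@le_lt_trans _ _ (empirical_measure Z [set y | - d <= dot (- c) y])).
    apply: ge_inf.
      by exists 0 => _ [H _ <-]; rewrite empirical_measureE divr_ge0.
    exists [set y | - d <= dot (- c) y] => //; split.
      by exists (- c), (- d); rewrite oppr_eq0.
    by rewrite /= dotNl lerN2.
  by rewrite empirical_measureE cardE ltr_pM2r ?invr_gt0// ltr_nat.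
Qed.

End Depth.

(** * The two inclusions between the regions *)

Theorem theorem4p2 (R : realType) (k n : nat) (Z : 'I_n -> 'cV[R]_k)
    (Gamma : 'cV[R]_k -> 'M[R]_(k, k.-1)) (l : nat) (tau : R)
    (k_gt0 : (0 < k)%N)
    (n_ge : (k.+1 <= n)%N)
    (Gamma_orth : forall u : 'cV[R]_k, unit_sphere u ->
       orthogonal_mx (row_mx u (Gamma u)))
    (Z_gp : general_position Z)
    (l_ge1 : (1 <= l)%N) (l_le : (l <= n - k)%N)
    (D_int : interior (depth_region Z (l%:R / n%:R)) !=set0)
    (tau_gt0 : 0 < tau)
    (tau_ge : (l%:R - 1) / n%:R <= tau) (tau_lt : tau < l%:R / n%:R) :
  quantile_region Z Gamma tau = depth_region Z (l%:R / n%:R).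
Proof.
have n0 : (0 < n)%N by exact: leq_ltn_trans n_ge.
have n0R : 0 < n%:R :> R by rewrite ltr0n.
have ln : (l <= n)%N := leq_trans l_le (leq_subr _ _).
have ntau_lt : n%:R * tau < l%:R by rewrite mulrC -ltr_pdivlMr.
have ntau_ge : l%:R - 1 <= n%:R * tau by rewrite mulrC -ler_pdivrMr.
have tau_lt1 : tau < 1.
  by apply: (lt_le_trans tau_lt); rewrite ler_pdivrMr// mul1r ler_nat.
apply/seteqP; split=> z hz.
- rewrite /depth_region /= leNgt; apply/negP => /(halfspace_depth_ltP _ _ _ k_gt0 n0).
  case=> c [d [c0 czd hl]].
  have /(exists_order_statistic (fun i => dot c (Z i)))[a /andP[aN aE]] :
    (0 < l <= n)%N by rewrite l_ge1.
  (* Fewer than [l] points reach level [d] from below, but at least [l] reach [a]. *)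
  have da : d < a.
    rewrite ltNge; apply/negP => ad.
    have : (l <= #|[pred i | (dot c (Z i) <= d)%R]|)%N.
      apply: leq_trans aE _; apply: subset_leq_card; apply/fintype.subsetP => i.
      by rewrite !inE => /le_trans; apply.
    by rewrite leqNgt hl.
  (* By general position a hyperplane holds at most [k < n] data points. *)
  have [i hi] : exists i, dot c (Z i) != a.
    apply/existsP; apply: contraT; rewrite negb_exists => /forallP h.
    have := Z_gp c a c0; rewrite (eq_card (B := predT)) ?card_ord.
      by rewrite leqNgt n_ge.
    move=> i; rewrite !inE; have := h i; rewrite negbK => /eqP hi.
    by apply/mem_set.
  (* The range of [tau] enters here: [#{< a} <= l - 1 <= n tau < l <= #{<= a}]. *)
  have [||||u us hu] := @exists_quantile_direction _ _ _ Z _ Gamma_orth tau c a.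
  + by rewrite tau_gt0.
  + by exists i.
  + apply: le_trans ntau_ge; rewrite lerBrDr natr1 ler_nat; exact: aN.
  + by apply: (le_trans (ltW ntau_lt)); rewrite ler_nat.
  have := hz u us _ hu => /=.
  by rewrite leNgt (le_lt_trans czd da).
- move=> u us _ [a [b [hab ->]]]; rewrite upper_halfspaceE /= leNgt; apply/negP => hlt.
  move: hz; rewrite /depth_region /= leNgt => /negP; apply.
  set c := u - _ in hlt.
  apply/halfspace_depth_ltP => //; exists c, (dot c z); split=> //.
    (* The normal [c] is nonzero because its component along [u] is 1. *)
    have [Gu _] := orthogonal_row_mx (Gamma_orth u us).
    apply/eqP => c0; have : dot c u = 1.
      by rewrite dotDl dotNl dot_mull Gu dot0r subr0 unit_sphere_dot.
    by rewrite c0 dot0l => /eqP; rewrite eq_sym oner_eq0.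
  (* As [dot c z < a], points on or below the level of [z] lie strictly below [a]: at most
     [n tau < l] of them. *)
  rewrite -(ltr_nat R); apply: le_lt_trans ntau_lt.
  apply: le_trans (quantile_coef_card_lt n0 (ltW tau_gt0) hab).
  rewrite ler_nat; apply: subset_leq_card; apply/fintype.subsetP => i.
  by rewrite !inE => /le_lt_trans; apply.
Qed.
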